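(* Let $A=(A_0,\dots,A_4)$ be a 4-restricted complete semi-Segal type. Then $A$ admits a 3-degeneracy structure.
   Context: Work in homotopy type theory with a univalent universe $\mathcal U$. Semi-Segal types. A 4-restricted semisimplicial type is a tuple $(A_0,\dots,A_4)$ with $A_0:\mathcal U$ and, for $1\le k\le 4$, $A_k:\partial\mathbf\Delta^k\to\mathcal U$. Here $\partial\mathbf\Delta^k$ is the iterated $\Sigma$-type with one component $x_S$ for every nonempty proper subset $S\subsetneq\{0,\dots,k\}$, where $x_S:A_{|S|-1}\big((x_T)_{\emptyset\ne T\subsetneq S}\big)$ (reindexed along the order-preserving bijection $S\cong\{0,\dots,|S|-1\}$), and $x_i:A_0$ for singletons. $\mathbf\Delta^k$ is the same $\Sigma$-type with one further component $x_{0\cdots k}:A_k(\ldots)$ over that boundary. For $2\le k\le 4$ and $0\le m\le k$, $\Lambda^k_m$ is the $\Sigma$-type with the same components as $\partial\mathbf\Delta^k$ except that $x_{\{0,\dots,k\}\setminus\{m\}}$ is removed. The type of fillers of $u:\Lambda^k_m$ is the type of pairs $(x_{\{0,\dots,k\}\setminus\{m\}},x_{\{0,\dots,k\}})$; $u$ has contractible filling if this type is contractible. A 4-restricted semi-Segal type is a 4-restricted semisimplicial type where all $\Lambda^p_1$-horns, $p\in\{2,3,4\}$, have contractible filling. An edge $e:A_1(a,b)$ is neutral if every horn $u:\Lambda^2_0$ with $u_{01}\equiv e$ and every horn $u:\Lambda^2_2$ with $u_{12}\equiv e$ has contractible filling; this proposition is written $\mathsf{isNeutral}(e)$. $A$ is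 complete if $\Pi(x:A_0),\ \mathsf{isContr}\big(\Sigma(y:A_0),(e:A_1(y,x)),\mathsf{isNeutral}(e)\big)$. Degeneracy structures. A 2-degeneracy structure is a function $s^0_0:\Pi(x_0:A_0),A_1(x_0,x_0)$ together with functions assigning to each $(x_0,x_1,x_{01}):\mathbf\Delta^1$ an element of $A_2(u)$ for the boundaries $u$: for $s^1_0$: $u_0=u_1=x_0$, $u_2=x_1$, $u_{01}=s^0_0(x_0)$, $u_{02}=u_{12}=x_{01}$; for $s^1_1$: $u_0=x_0$, $u_1=u_2=x_1$, $u_{01}=u_{02}=x_{01}$, $u_{12}=s^0_0(x_1)$. A 3-degeneracy structure is a 2-degeneracy structure together with functions assigning to each $x:\mathbf\Delta^2$ (with components $x_0,x_1,x_2,x_{01},x_{12},x_{02},x_{012}$) an element of $A_3(u)$ for the boundaries $u$: for $s^2_0$: $u_0=u_1=x_0$, $u_2=x_1$, $u_3=x_2$; $u_{01}=s^0_0(x_0)$, $u_{02}=u_{12}=x_{01}$, $u_{03}=u_{13}=x_{02}$, $u_{23}=x_{12}$; $u_{012}=s^1_0(x_{01})$, $u_{013}=s^1_0(x_{02})$, $u_{023}=u_{123}=x_{012}$; for $s^2_1$: $u_0=x_0$, $u_1=u_2=x_1$, $u_3=x_2$; $u_{01}=u_{02}=x_{01}$, $u_{12}=s^0_0(x_1)$, $u_{03}=x_{02}$, $u_{13}=u_{23}=x_{12}$; $u_{012}=s^1_1(x_{01})$, $u_{013}=u_{023}=x_{012}$, $u_{123}=s^1_0(x_{12})$; for $s^2_2$: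 $u_0=x_0$, $u_1=x_1$, $u_2=u_3=x_2$; $u_{01}=x_{01}$, $u_{02}=u_{03}=x_{02}$, $u_{12}=u_{13}=x_{12}$, $u_{23}=s^0_0(x_2)$; $u_{012}=u_{013}=x_{012}$, $u_{023}=s^1_1(x_{02})$, $u_{123}=s^1_1(x_{12})$. *)

(* Defs.v *)
(* The development is carried out in plain intensional type theory: the identity
   type lives in [Type], so that it may be iterated and is not truncated (unlike
   [eq], which lives in [Prop]).  No univalence axiom is assumed, so [U] may in
   particular be read as a univalent universe. *)
Definition U := Type.

Inductive paths {X : U} (x : X) : X -> U := idpath : paths x x.

Definition isContr (X : U) : U := { c : X & forall y : X, paths c y }.

(* Iterated Sigma-types are records with primitive projections, hence satisfy
   eta definitionally.  In component names, the digits after the underscore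
   form the subset S of {0,...,k} that indexes the component; components are
   ordered by cardinality, then lexicographically. *)
Set Primitive Projections.

Record bdry1 (A0 : U) : U := Bdry1 {
  b1_0 : A0;
  b1_1 : A0
}.
Arguments Bdry1 {A0} _ _.
Arguments b1_0 {A0} _.
Arguments b1_1 {A0} _.

Record bdry2 {A0 : U} (A1 : bdry1 A0 -> U) : U := Bdry2 {
  b2_0 : A0;
  b2_1 : A0;
  b2_2 : A0;
  b2_01 : A1 (Bdry1 b2_0 b2_1);
  b2_02 : A1 (Bdry1 b2_0 b2_2);
  b2_12 : A1 (Bdry1 b2_1 b2_2)
}.
Arguments Bdry2 {A0} {A1} _ _ _ _ _ _.
Arguments b2_0 {A0} {A1} _.
Arguments b2_1 {A0} {A1} _.
Arguments b2_2 {A0} {A1} _.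
Arguments b2_01 {A0} {A1} _.
Arguments b2_02 {A0} {A1} _.
Arguments b2_12 {A0} {A1} _.

Record bdry3 {A0 : U} {A1 : bdry1 A0 -> U} (A2 : bdry2 A1 -> U) : U := Bdry3 {
  b3_0 : A0;
  b3_1 : A0;
  b3_2 : A0;
  b3_3 : A0;
  b3_01 : A1 (Bdry1 b3_0 b3_1);
  b3_02 : A1 (Bdry1 b3_0 b3_2);
  b3_03 : A1 (Bdry1 b3_0 b3_3);
  b3_12 : A1 (Bdry1 b3_1 b3_2);
  b3_13 : A1 (Bdry1 b3_1 b3_3);
  b3_23 : A1 (Bdry1 b3_2 b3_3);
  b3_012 : A2 (Bdry2 b3_0 b3_1 b3_2 b3_01 b3_02 b3_12);
  b3_013 : A2 (Bdry2 b3_0 b3_1 b3_3 b3_01 b3_03 b3_13);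
  b3_023 : A2 (Bdry2 b3_0 b3_2 b3_3 b3_02 b3_03 b3_23);
  b3_123 : A2 (Bdry2 b3_1 b3_2 b3_3 b3_12 b3_13 b3_23)
}.
Arguments Bdry3 {A0} {A1} {A2} _ _ _ _ _ _ _ _ _ _ _ _ _ _.

Record bdry4 {A0 : U} {A1 : bdry1 A0 -> U} {A2 : bdry2 A1 -> U}
    (A3 : bdry3 A2 -> U) : U := Bdry4 {
  b4_0 : A0;
  b4_1 : A0;
  b4_2 : A0;
  b4_3 : A0;
  b4_4 : A0;
  b4_01 : A1 (Bdry1 b4_0 b4_1);
  b4_02 : A1 (Bdry1 b4_0 b4_2);
  b4_03 : A1 (Bdry1 b4_0 b4_3);
  b4_04 : A1 (Bdry1 b4_0 b4_4);
  b4_12 : A1 (Bdry1 b4_1 b4_2);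
  b4_13 : A1 (Bdry1 b4_1 b4_3);
  b4_14 : A1 (Bdry1 b4_1 b4_4);
  b4_23 : A1 (Bdry1 b4_2 b4_3);
  b4_24 : A1 (Bdry1 b4_2 b4_4);
  b4_34 : A1 (Bdry1 b4_3 b4_4);
  b4_012 : A2 (Bdry2 b4_0 b4_1 b4_2 b4_01 b4_02 b4_12);
  b4_013 : A2 (Bdry2 b4_0 b4_1 b4_3 b4_01 b4_03 b4_13);
  b4_014 : A2 (Bdry2 b4_0 b4_1 b4_4 b4_01 b4_04 b4_14);
  b4_023 : A2 (Bdry2 b4_0 b4_2 b4_3 b4_02 b4_03 b4_23);
  b4_024 : A2 (Bdry2 b4_0 b4_2 b4_4 b4_02 b4_04 b4_24);
  b4_034 : A2 (Bdry2 b4_0 b4_3 b4_4 b4_03 b4_04 b4_34);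
  b4_123 : A2 (Bdry2 b4_1 b4_2 b4_3 b4_12 b4_13 b4_23);
  b4_124 : A2 (Bdry2 b4_1 b4_2 b4_4 b4_12 b4_14 b4_24);
  b4_134 : A2 (Bdry2 b4_1 b4_3 b4_4 b4_13 b4_14 b4_34);
  b4_234 : A2 (Bdry2 b4_2 b4_3 b4_4 b4_23 b4_24 b4_34);
  b4_0123 :
    A3 (Bdry3 b4_0 b4_1 b4_2 b4_3 b4_01 b4_02 b4_03 b4_12 b4_13 b4_23 b4_012
      b4_013 b4_023 b4_123);
  b4_0124 :
    A3 (Bdry3 b4_0 b4_1 b4_2 b4_4 b4_01 b4_02 b4_04 b4_12 b4_14 b4_24 b4_012
      b4_014 b4_024 b4_124);
  b4_0134 :
    A3 (Bdry3 b4_0 b4_1 b4_3 b4_4 b4_01 b4_03 b4_04 b4_13 b4_14 b4_34 b4_013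
      b4_014 b4_034 b4_134);
  b4_0234 :
    A3 (Bdry3 b4_0 b4_2 b4_3 b4_4 b4_02 b4_03 b4_04 b4_23 b4_24 b4_34 b4_023
      b4_024 b4_034 b4_234);
  b4_1234 :
    A3 (Bdry3 b4_1 b4_2 b4_3 b4_4 b4_12 b4_13 b4_14 b4_23 b4_24 b4_34 b4_123
      b4_124 b4_134 b4_234)
}.
Arguments Bdry4 {A0} {A1} {A2} {A3}
  _ _ _ _ _ _ _ _ _ _ _ _ _ _ _ _ _ _ _ _ _ _ _ _ _ _ _ _ _ _.

(* [hornk_m] is the horn of dimension k lacking the facet opposite to m. *)
Record horn2_0 {A0 : U} (A1 : bdry1 A0 -> U) : U := Horn2_0 {
  h20_0 : A0;
  h20_1 : A0;
  h20_2 : A0;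
  h20_01 : A1 (Bdry1 h20_0 h20_1);
  h20_02 : A1 (Bdry1 h20_0 h20_2)
}.
Arguments Horn2_0 {A0} {A1} _ _ _ _ _.

Definition filler2_0 {A0 : U} {A1 : bdry1 A0 -> U}
    (A2 : bdry2 A1 -> U) (u : horn2_0 A1) : U :=
  let '(Horn2_0 x0 x1 x2 x01 x02) := u in
  { x12 : A1 (Bdry1 x1 x2) &
    A2 (Bdry2 x0 x1 x2 x01 x02 x12) }.

Record horn2_1 {A0 : U} (A1 : bdry1 A0 -> U) : U := Horn2_1 {
  h21_0 : A0;
  h21_1 : A0;
  h21_2 : A0;
  h21_01 : A1 (Bdry1 h21_0 h21_1);
  h21_12 : A1 (Bdry1 h21_1 h21_2)
}.
Arguments Horn2_1 {A0} {A1} _ _ _ _ _.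

Definition filler2_1 {A0 : U} {A1 : bdry1 A0 -> U}
    (A2 : bdry2 A1 -> U) (u : horn2_1 A1) : U :=
  let '(Horn2_1 x0 x1 x2 x01 x12) := u in
  { x02 : A1 (Bdry1 x0 x2) &
    A2 (Bdry2 x0 x1 x2 x01 x02 x12) }.

Record horn2_2 {A0 : U} (A1 : bdry1 A0 -> U) : U := Horn2_2 {
  h22_0 : A0;
  h22_1 : A0;
  h22_2 : A0;
  h22_02 : A1 (Bdry1 h22_0 h22_2);
  h22_12 : A1 (Bdry1 h22_1 h22_2)
}.
Arguments Horn2_2 {A0} {A1} _ _ _ _ _.

Definition filler2_2 {A0 : U} {A1 : bdry1 A0 -> U}
    (A2 : bdry2 A1 -> U) (u : horn2_2 A1) : U :=
  let '(Horn2_2 x0 x1 x2 x02 x12) := u in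
  { x01 : A1 (Bdry1 x0 x1) &
    A2 (Bdry2 x0 x1 x2 x01 x02 x12) }.

Record horn3_1 {A0 : U} {A1 : bdry1 A0 -> U} (A2 : bdry2 A1 -> U)
    : U := Horn3_1 {
  h31_0 : A0;
  h31_1 : A0;
  h31_2 : A0;
  h31_3 : A0;
  h31_01 : A1 (Bdry1 h31_0 h31_1);
  h31_02 : A1 (Bdry1 h31_0 h31_2);
  h31_03 : A1 (Bdry1 h31_0 h31_3);
  h31_12 : A1 (Bdry1 h31_1 h31_2);
  h31_13 : A1 (Bdry1 h31_1 h31_3);
  h31_23 : A1 (Bdry1 h31_2 h31_3);
  h31_012 : A2 (Bdry2 h31_0 h31_1 h31_2 h31_01 h31_02 h31_12);
  h31_013 : A2 (Bdry2 h31_0 h31_1 h31_3 h31_01 h31_03 h31_13);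
  h31_123 : A2 (Bdry2 h31_1 h31_2 h31_3 h31_12 h31_13 h31_23)
}.
Arguments Horn3_1 {A0} {A1} {A2} _ _ _ _ _ _ _ _ _ _ _ _ _.

Definition filler3_1 {A0 : U} {A1 : bdry1 A0 -> U} {A2 : bdry2 A1 -> U}
    (A3 : bdry3 A2 -> U) (u : horn3_1 A2) : U :=
  let '(Horn3_1 x0 x1 x2 x3 x01 x02 x03 x12 x13 x23 x012 x013 x123) := u in
  { x023 : A2 (Bdry2 x0 x2 x3 x02 x03 x23) &
    A3 (Bdry3 x0 x1 x2 x3 x01 x02 x03 x12 x13 x23 x012 x013 x023 x123) }.

Record horn4_1 {A0 : U} {A1 : bdry1 A0 -> U} {A2 : bdry2 A1 -> U}
    (A3 : bdry3 A2 -> U) : U := Horn4_1 {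
  h41_0 : A0;
  h41_1 : A0;
  h41_2 : A0;
  h41_3 : A0;
  h41_4 : A0;
  h41_01 : A1 (Bdry1 h41_0 h41_1);
  h41_02 : A1 (Bdry1 h41_0 h41_2);
  h41_03 : A1 (Bdry1 h41_0 h41_3);
  h41_04 : A1 (Bdry1 h41_0 h41_4);
  h41_12 : A1 (Bdry1 h41_1 h41_2);
  h41_13 : A1 (Bdry1 h41_1 h41_3);
  h41_14 : A1 (Bdry1 h41_1 h41_4);
  h41_23 : A1 (Bdry1 h41_2 h41_3);
  h41_24 : A1 (Bdry1 h41_2 h41_4);
  h41_34 : A1 (Bdry1 h41_3 h41_4);
  h41_012 : A2 (Bdry2 h41_0 h41_1 h41_2 h41_01 h41_02 h41_12);
  h41_013 : A2 (Bdry2 h41_0 h41_1 h41_3 h41_01 h41_03 h41_13);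
  h41_014 : A2 (Bdry2 h41_0 h41_1 h41_4 h41_01 h41_04 h41_14);
  h41_023 : A2 (Bdry2 h41_0 h41_2 h41_3 h41_02 h41_03 h41_23);
  h41_024 : A2 (Bdry2 h41_0 h41_2 h41_4 h41_02 h41_04 h41_24);
  h41_034 : A2 (Bdry2 h41_0 h41_3 h41_4 h41_03 h41_04 h41_34);
  h41_123 : A2 (Bdry2 h41_1 h41_2 h41_3 h41_12 h41_13 h41_23);
  h41_124 : A2 (Bdry2 h41_1 h41_2 h41_4 h41_12 h41_14 h41_24);
  h41_134 : A2 (Bdry2 h41_1 h41_3 h41_4 h41_13 h41_14 h41_34);
  h41_234 : A2 (Bdry2 h41_2 h41_3 h41_4 h41_23 h41_24 h41_34);
  h41_0123 :
    A3 (Bdry3 h41_0 h41_1 h41_2 h41_3 h41_01 h41_02 h41_03 h41_12 h41_13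
      h41_23 h41_012 h41_013 h41_023 h41_123);
  h41_0124 :
    A3 (Bdry3 h41_0 h41_1 h41_2 h41_4 h41_01 h41_02 h41_04 h41_12 h41_14
      h41_24 h41_012 h41_014 h41_024 h41_124);
  h41_0134 :
    A3 (Bdry3 h41_0 h41_1 h41_3 h41_4 h41_01 h41_03 h41_04 h41_13 h41_14
      h41_34 h41_013 h41_014 h41_034 h41_134);
  h41_1234 :
    A3 (Bdry3 h41_1 h41_2 h41_3 h41_4 h41_12 h41_13 h41_14 h41_23 h41_24
      h41_34 h41_123 h41_124 h41_134 h41_234)
}.
Arguments Horn4_1 {A0} {A1} {A2} {A3}
  _ _ _ _ _ _ _ _ _ _ _ _ _ _ _ _ _ _ _ _ _ _ _ _ _ _ _ _ _.

Definition filler4_1 {A0 : U} {A1 : bdry1 A0 -> U} {A2 : bdry2 A1 -> U}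
    {A3 : bdry3 A2 -> U} (A4 : bdry4 A3 -> U) (u : horn4_1 A3) : U :=
  let '(Horn4_1 x0 x1 x2 x3 x4 x01 x02 x03 x04 x12 x13 x14 x23 x24 x34 x012
    x013 x014 x023 x024 x034 x123 x124 x134 x234 x0123 x0124 x0134 x1234)
  := u in
  { x0234 : A3 (Bdry3 x0 x2 x3 x4 x02 x03 x04 x23 x24 x34 x023 x024 x034 x234) &
    A4 (Bdry4 x0 x1 x2 x3 x4 x01 x02 x03 x04 x12 x13 x14 x23 x24 x34 x012 x013
        x014 x023 x024 x034 x123 x124 x134 x234 x0123 x0124 x0134 x0234
        x1234) }.

Record sst4 := SST4 {
  A0 : U;
  A1 : bdry1 A0 -> U;
  A2 : bdry2 A1 -> U;
  A3 : bdry3 A2 -> U;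
  A4 : bdry4 A3 -> U
}.

Record simplex1 (A : sst4) : U := Simplex1 {
  simplex1_bd :> bdry1 (A0 A);
  simplex1_01 : A1 A simplex1_bd
}.
Arguments simplex1_01 {A} _.

Record simplex2 (A : sst4) : U := Simplex2 {
  simplex2_bd :> bdry2 (A1 A);
  simplex2_012 : A2 A simplex2_bd
}.
Arguments simplex2_012 {A} _.

Record isSemiSegal (A : sst4) : U := {
  contr_horn2_1 : forall u : horn2_1 (A1 A), isContr (filler2_1 (A2 A) u);
  contr_horn3_1 : forall u : horn3_1 (A2 A), isContr (filler3_1 (A3 A) u);
  contr_horn4_1 : forall u : horn4_1 (A3 A), isContr (filler4_1 (A4 A) u)
}.

(* Both horns having [e] as the indicated edge: a = u_0, b = u_1 in the first
   case, and a = u_1, b = u_2 in the second one. *)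
Definition isNeutral (A : sst4) (a b : A0 A) (e : A1 A (Bdry1 a b)) : U :=
  ((forall (c : A0 A) (f : A1 A (Bdry1 a c)),
      isContr (filler2_0 (A2 A) (Horn2_0 a b c e f))) *
   (forall (c : A0 A) (f : A1 A (Bdry1 c b)),
      isContr (filler2_2 (A2 A) (Horn2_2 c a b f e))))%type.

Definition isComplete (A : sst4) : U :=
  forall x : A0 A,
    isContr { y : A0 A & { e : A1 A (Bdry1 y x) & isNeutral A y x e } }.

Record degeneracy2 (A : sst4) : U := {
  s0_0 : forall x0 : A0 A, A1 A (Bdry1 x0 x0);
  s1_0 : forall x : simplex1 A,
    let x0 := b1_0 x in let x1 := b1_1 x in let x01 := simplex1_01 x in
    A2 A (Bdry2 x0 x0 x1 (s0_0 x0) x01 x01);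
  s1_1 : forall x : simplex1 A,
    let x0 := b1_0 x in let x1 := b1_1 x in let x01 := simplex1_01 x in
    A2 A (Bdry2 x0 x1 x1 x01 x01 (s0_0 x1))
}.
Arguments s0_0 {A} _ _.
Arguments s1_0 {A} _ _.
Arguments s1_1 {A} _ _.

Record degeneracy3 (A : sst4) : U := {
  deg2 :> degeneracy2 A;
  s2_0 : forall x : simplex2 A,
    let x0 := b2_0 x in let x1 := b2_1 x in let x2 := b2_2 x in
    let x01 := b2_01 x in let x02 := b2_02 x in let x12 := b2_12 x in
    let x012 := simplex2_012 x in
    A3 A (Bdry3 x0 x0 x1 x2
                (s0_0 deg2 x0) x01 x02 x01 x02 x12
                (s1_0 deg2 (Simplex1 A (Bdry1 x0 x1) x01))
                (s1_0 deg2 (Simplex1 A (Bdry1 x0 x2) x02))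
                x012 x012);
  s2_1 : forall x : simplex2 A,
    let x0 := b2_0 x in let x1 := b2_1 x in let x2 := b2_2 x in
    let x01 := b2_01 x in let x02 := b2_02 x in let x12 := b2_12 x in
    let x012 := simplex2_012 x in
    A3 A (Bdry3 x0 x1 x1 x2
                x01 x01 x02 (s0_0 deg2 x1) x12 x12
                (s1_1 deg2 (Simplex1 A (Bdry1 x0 x1) x01))
                x012 x012
                (s1_0 deg2 (Simplex1 A (Bdry1 x1 x2) x12)));
  s2_2 : forall x : simplex2 A,
    let x0 := b2_0 x in let x1 := b2_1 x in let x2 := b2_2 x in
    let x01 := b2_01 x in let x02 := b2_02 x in let x12 := b2_12 x in
    let x012 := simplex2_012 x in
    A3 A (Bdry3 x0 x1 x2 x2
                x01 x02 x02 x12 x12 (s0_0 deg2 x2)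
                x012 x012
                (s1_1 deg2 (Simplex1 A (Bdry1 x0 x2) x02))
                (s1_1 deg2 (Simplex1 A (Bdry1 x1 x2) x12)))
}.

(* Main.v *)
Require Import Defs.

(** The completeness of [A] provides, for every [x], a neutral edge [e : y -> x].
    Composition with [e] is invertible on both sides, so there is a unique edge
    [i : x -> x] with a triangle [w] exhibiting [i] after [e] as [e].  This [i]
    is the degeneracy of [x], and it acts as an identity because it does so
    after [e] and [e] can be cancelled.

    All degeneracies arise as the missing face of one horn whose other faces
    come in equal pairs.  For [f : x -> z], the 3-horn on [y, x, x, z] with the
    faces [w] and twice the composite triangle of [e] and [f] has as missing
    face a triangle [i, f, f]: the left degeneracy of [f] ([left_unitor]).  For
    [f : z -> x], write [f] as [e] after some [f' : z -> y]; the horn on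
    [z, y, x, x] with the face [w] and twice the triangle [f', f, e] is missing
    a triangle [f, f, i]: the right degeneracy ([right_unitor]).  One dimension
    up, the tetrahedra just built serve as faces of a 4-horn whose remaining two
    faces are equal copies of an extension of the given triangle [s] by [e]; the
    missing face is the required degeneracy of [s].  Since the triangle
    degeneracies are chosen together with these tetrahedra, the faces of the
    4-horns fit on the nose, and no separately chosen degeneracies ever have to
    be compared.

    Some of these horns are not of the form that the Segal condition fills: the
    outer ones use the neutrality of an edge, the others are inner.  Their
    fillers are obtained from those of the Segal horns by trading one missing
    face for an adjacent one ([isContr_exchange]). *)

(** * Contractible types *)

Lemma transport_contr {X : U} (c : isContr X) (P : X -> U) (x y : X) :
  P x -> P y.
Proof.
  destruct c as [c h]; intros p.
  destruct (h y); destruct (h x); exact p.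
Defined.

(** The transport goes from [x] to the center and from there to [y].  For equal
    [x] and [y] the two halves cancel, so that no appeal to contractible types
    being sets is made. *)
Lemma transport_contr_refl {X : U} (c : isContr X) (P : X -> U) (x : X)
    (p : P x) :
  paths (transport_contr c P x x p) p.
Proof.
  destruct c as [c h]; cbn; destruct (h x); apply idpath.
Defined.

Lemma isContr_retract {X Y : U} (r : X -> Y) (s : Y -> X)
    (rs : forall y, paths (r (s y)) y) :
  isContr X -> isContr Y.
Proof.
  intros [c h]; exists (r c); intros y.
  destruct (rs y); destruct (h (s y)); apply idpath.
Defined.

Lemma isContr_total {X : U} (P : X -> U) (c : isContr X)
    (d : forall x, isContr (P x)) :
  isContr { x : X & P x }.
Proof.
  apply (isContr_retract
           (fun p : P (projT1 c) => existT P (projT1 c) p)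
           (fun z => transport_contr c P (projT1 z) (projT1 c) (projT2 z)));
    [| apply d].
  intros [x p]; cbn; destruct c as [c h]; cbn.
  destruct (h x); destruct (h c); apply idpath.
Defined.

Lemma isContr_fiber {X : U} (P : X -> U) (c : isContr X)
    (d : isContr { x : X & P x }) (x : X) :
  isContr (P x).
Proof.
  refine (isContr_retract
            (fun z : { x : X & P x } => transport_contr c P (projT1 z) x (projT2 z))
            (fun p => existT P x p) _ d).
  intros p; apply transport_contr_refl.
Defined.

(** In the applications, [P] and [Q] are the types of two facets of a simplex
    that share the codimension-2 face [x], and [R] is the type of simplices with
    these facets.  Both ways of adding [x] together with one facet, and one way
    of adding the other facet together with the interior, are unique.  Adding
    all four is then unique, so the second way of splitting this off in two
    steps is unique as well. *)
Lemma isContr_exchange {X : U} {P Q : X -> U} (R : forall x, P x -> Q x -> U)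
    (cP : isContr { x : X & P x })
    (cR : forall x p, isContr { q : Q x & R x p q })
    (cQ : isContr { x : X & Q x })
    (x : X) (q : Q x) :
  isContr { p : P x & R x p q }.
Proof.
  refine (isContr_fiber
            (fun z : { x : X & Q x } =>
               { p : P (projT1 z) & R (projT1 z) p (projT2 z) })
            cQ _ (existT Q x q)).
  unshelve refine (isContr_retract _ _ _
            (isContr_total
               (fun z : { x : X & P x } =>
                  { q : Q (projT1 z) & R (projT1 z) (projT2 z) q })
               cP (fun z => cR (projT1 z) (projT2 z)))).
  - intros [[x' p'] [q' r']]; exact (existT _ (existT Q x' q') (existT _ p' r')).
  - intros [[x' q'] [p' r']]; exact (existT _ (existT P x' p') (existT _ q' r')).
  - intros [[x' q'] [p' r']]; apply idpath.
Defined.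

(** * Fillers of further horns *)

(** The two facets traded are 013 and 023, which share the edge 03. *)
Lemma isContr_filler3_2 {A : sst4} (segal : isSemiSegal A)
    x0 x1 x2 x3 x01 x02 x03 x12 x13 x23 x012 x023 x123 :
  isContr { x013 : A2 A (Bdry2 x0 x1 x3 x01 x03 x13) &
    A3 A (Bdry3 x0 x1 x2 x3 x01 x02 x03 x12 x13 x23 x012 x013 x023 x123) }.
Proof.
  exact (isContr_exchange
    (fun x03 x013 x023 =>
       A3 A (Bdry3 x0 x1 x2 x3 x01 x02 x03 x12 x13 x23 x012 x013 x023 x123))
    (contr_horn2_1 A segal (Horn2_1 x0 x1 x3 x01 x13))
    (fun x03 x013 => contr_horn3_1 A segal
       (Horn3_1 x0 x1 x2 x3 x01 x02 x03 x12 x13 x23 x012 x013 x123))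
    (contr_horn2_1 A segal (Horn2_1 x0 x2 x3 x02 x23))
    x03 x023).
Qed.

(** The edge 13, common to 013 and 123, is determined by 01 and 03 because 01 is
    neutral. *)
Lemma isContr_filler3_0 {A : sst4} (segal : isSemiSegal A)
    x0 x1 x2 x3 x01 (n01 : isNeutral A x0 x1 x01)
    x02 x03 x12 x13 x23 x012 x013 x023 :
  isContr { x123 : A2 A (Bdry2 x1 x2 x3 x12 x13 x23) &
    A3 A (Bdry3 x0 x1 x2 x3 x01 x02 x03 x12 x13 x23 x012 x013 x023 x123) }.
Proof.
  exact (isContr_exchange
    (fun x13 x123 x013 =>
       A3 A (Bdry3 x0 x1 x2 x3 x01 x02 x03 x12 x13 x23 x012 x013 x023 x123))
    (contr_horn2_1 A segal (Horn2_1 x1 x2 x3 x12 x23))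
    (fun x13 x123 => isContr_filler3_2 segal
       x0 x1 x2 x3 x01 x02 x03 x12 x13 x23 x012 x023 x123)
    (fst n01 x3 x03)
    x13 x013).
Qed.

(** The edge 02, common to 012 and 023, is determined by 03 and 23 because 23 is
    neutral. *)
Lemma isContr_filler3_3 {A : sst4} (segal : isSemiSegal A)
    x0 x1 x2 x3 x23 (n23 : isNeutral A x2 x3 x23)
    x01 x02 x03 x12 x13 x013 x023 x123 :
  isContr { x012 : A2 A (Bdry2 x0 x1 x2 x01 x02 x12) &
    A3 A (Bdry3 x0 x1 x2 x3 x01 x02 x03 x12 x13 x23 x012 x013 x023 x123) }.
Proof.
  exact (isContr_exchange
    (fun x02 x012 x023 =>
       A3 A (Bdry3 x0 x1 x2 x3 x01 x02 x03 x12 x13 x23 x012 x013 x023 x123))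
    (contr_horn2_1 A segal (Horn2_1 x0 x1 x2 x01 x12))
    (fun x02 x012 => contr_horn3_1 A segal
       (Horn3_1 x0 x1 x2 x3 x01 x02 x03 x12 x13 x23 x012 x013 x123))
    (snd n23 x0 x03)
    x02 x023).
Qed.

(** The two facets traded are 0134 and 0234, which share the triangle 034. *)
Lemma isContr_filler4_2 {A : sst4} (segal : isSemiSegal A)
    x0 x1 x2 x3 x4 x01 x02 x03 x04 x12 x13 x14 x23 x24 x34
    x012 x013 x014 x023 x024 x034 x123 x124 x134 x234
    x0123 x0124 x0234 x1234 :
  isContr { x0134 :
    A3 A (Bdry3 x0 x1 x3 x4 x01 x03 x04 x13 x14 x34 x013 x014 x034 x134) &
    A4 A (Bdry4 x0 x1 x2 x3 x4 x01 x02 x03 x04 x12 x13 x14 x23 x24 x34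
      x012 x013 x014 x023 x024 x034 x123 x124 x134 x234
      x0123 x0124 x0134 x0234 x1234) }.
Proof.
  exact (isContr_exchange
    (fun x034 x0134 x0234 =>
       A4 A (Bdry4 x0 x1 x2 x3 x4 x01 x02 x03 x04 x12 x13 x14 x23 x24 x34
         x012 x013 x014 x023 x024 x034 x123 x124 x134 x234
         x0123 x0124 x0134 x0234 x1234))
    (contr_horn3_1 A segal
       (Horn3_1 x0 x1 x3 x4 x01 x03 x04 x13 x14 x34 x013 x014 x134))
    (fun x034 x0134 => contr_horn4_1 A segal
       (Horn4_1 x0 x1 x2 x3 x4 x01 x02 x03 x04 x12 x13 x14 x23 x24 x34
         x012 x013 x014 x023 x024 x034 x123 x124 x134 x234
         x0123 x0124 x0134 x1234))
    (contr_horn3_1 A segal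
       (Horn3_1 x0 x2 x3 x4 x02 x03 x04 x23 x24 x34 x023 x024 x234))
    x034 x0234).
Qed.

(** The triangle 134, common to 0134 and 1234, is determined by the other faces
    of 0134 because 01 is neutral. *)
Lemma isContr_filler4_0 {A : sst4} (segal : isSemiSegal A)
    x0 x1 x2 x3 x4 x01 (n01 : isNeutral A x0 x1 x01)
    x02 x03 x04 x12 x13 x14 x23 x24 x34
    x012 x013 x014 x023 x024 x034 x123 x124 x134 x234
    x0123 x0124 x0134 x0234 :
  isContr { x1234 :
    A3 A (Bdry3 x1 x2 x3 x4 x12 x13 x14 x23 x24 x34 x123 x124 x134 x234) &
    A4 A (Bdry4 x0 x1 x2 x3 x4 x01 x02 x03 x04 x12 x13 x14 x23 x24 x34
      x012 x013 x014 x023 x024 x034 x123 x124 x134 x234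
      x0123 x0124 x0134 x0234 x1234) }.
Proof.
  exact (isContr_exchange
    (fun x134 x1234 x0134 =>
       A4 A (Bdry4 x0 x1 x2 x3 x4 x01 x02 x03 x04 x12 x13 x14 x23 x24 x34
         x012 x013 x014 x023 x024 x034 x123 x124 x134 x234
         x0123 x0124 x0134 x0234 x1234))
    (contr_horn3_1 A segal
       (Horn3_1 x1 x2 x3 x4 x12 x13 x14 x23 x24 x34 x123 x124 x234))
    (fun x134 x1234 => isContr_filler4_2 segal
       x0 x1 x2 x3 x4 x01 x02 x03 x04 x12 x13 x14 x23 x24 x34
       x012 x013 x014 x023 x024 x034 x123 x124 x134 x234
       x0123 x0124 x0234 x1234)
    (isContr_filler3_0 segal x0 x1 x3 x4 x01 n01 x03 x04 x13 x14 x34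
       x013 x014 x034)
    x134 x0134).
Qed.

(** * Identities and unitors *)

(** The neutral edge is kept because it is what every coherence of the identity
    is derived from. *)
Record identity (A : sst4) (x : A0 A) : U := Identity {
  id_src : A0 A;
  id_ntr : A1 A (Bdry1 id_src x);
  id_isNeutral : isNeutral A id_src x id_ntr;
  id_edge : A1 A (Bdry1 x x);
  id_absorb : A2 A (Bdry2 id_src x x id_ntr id_ntr id_edge)
}.
Arguments id_src {A x} _.
Arguments id_ntr {A x} _.
Arguments id_isNeutral {A x} _.
Arguments id_edge {A x} _.
Arguments id_absorb {A x} _.

Lemma complete_identity {A : sst4} (complete : isComplete A) (x : A0 A) :
  identity A x.
Proof.
  destruct (complete x) as [[y [e n]] _].
  destruct (fst n x e) as [[i w] _].
  exact (Identity A x y e n i w).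
Defined.

(** Carrying [lu_coh] along with [lu_tri] pins down the latter up to
    contractible choice, and [lu_coh] is a face of the horns that define the
    degeneracies of triangles. *)
Record left_unitor {A : sst4} {x : A0 A} (i : identity A x) {z : A0 A}
    (f : A1 A (Bdry1 x z)) : U := LeftUnitor {
  lu_edge : A1 A (Bdry1 (id_src i) z);
  lu_comp : A2 A (Bdry2 (id_src i) x z (id_ntr i) lu_edge f);
  lu_tri : A2 A (Bdry2 x x z (id_edge i) f f);
  lu_coh : A3 A (Bdry3 (id_src i) x x z
                   (id_ntr i) (id_ntr i) lu_edge (id_edge i) f f
                   (id_absorb i) lu_comp lu_comp lu_tri)
}.
Arguments LeftUnitor {A x i z f} _ _ _ _.
Arguments lu_edge {A x i z f} _.
Arguments lu_comp {A x i z f} _.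
Arguments lu_tri {A x i z f} _.
Arguments lu_coh {A x i z f} _.

(** The composite [lu_edge] of [id_ntr i] and [f] is unchanged when
    [id_edge i] is inserted between them; [id_ntr i] is then cancelled. *)
Lemma has_left_unitor {A : sst4} (segal : isSemiSegal A) {x : A0 A}
    (i : identity A x) {z : A0 A} (f : A1 A (Bdry1 x z)) :
  left_unitor i f.
Proof.
  destruct (contr_horn2_1 A segal (Horn2_1 (id_src i) x z (id_ntr i) f))
    as [[h c] _].
  destruct (isContr_filler3_0 segal (id_src i) x x z
              (id_ntr i) (id_isNeutral i)
              (id_ntr i) h (id_edge i) f f (id_absorb i) c c) as [[s k] _].
  exact (LeftUnitor h c s k).
Qed.

(** Dual to [left_unitor], with [ru_edge] a factor of [f] through the neutral
    edge instead of a composite with it. *)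
Record right_unitor {A : sst4} {x : A0 A} (i : identity A x) {z : A0 A}
    (f : A1 A (Bdry1 z x)) : U := RightUnitor {
  ru_edge : A1 A (Bdry1 z (id_src i));
  ru_comp : A2 A (Bdry2 z (id_src i) x ru_edge f (id_ntr i));
  ru_tri : A2 A (Bdry2 z x x f f (id_edge i));
  ru_coh : A3 A (Bdry3 z (id_src i) x x
                   ru_edge f f (id_ntr i) (id_ntr i) (id_edge i)
                   ru_comp ru_comp ru_tri (id_absorb i))
}.
Arguments RightUnitor {A x i z f} _ _ _ _.
Arguments ru_edge {A x i z f} _.
Arguments ru_comp {A x i z f} _.
Arguments ru_tri {A x i z f} _.
Arguments ru_coh {A x i z f} _.

(** Since [f] is [id_ntr i] after [ru_edge] and [id_edge i] absorbs
    [id_ntr i], it also absorbs [f]. *)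
Lemma has_right_unitor {A : sst4} (segal : isSemiSegal A) {x : A0 A}
    (i : identity A x) {z : A0 A} (f : A1 A (Bdry1 z x)) :
  right_unitor i f.
Proof.
  destruct (snd (id_isNeutral i) z f) as [[g q] _].
  destruct (contr_horn3_1 A segal
              (Horn3_1 z (id_src i) x x g f f (id_ntr i) (id_ntr i) (id_edge i)
                 q q (id_absorb i))) as [[s k] _].
  exact (RightUnitor g q s k).
Qed.

(** * Degeneracies of triangles *)

(** The 4-horn has the vertices [id_src i, x0, x0, x1, x2], and its two equal
    faces are the extension of [x012] by the neutral edge into [x0]. *)
Lemma degenerate_first {A : sst4} (segal : isSemiSegal A) {x0 x1 x2 : A0 A}
    (i : identity A x0) {x01 x02 x12}
    (u01 : left_unitor i x01) (u02 : left_unitor i x02)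
    (x012 : A2 A (Bdry2 x0 x1 x2 x01 x02 x12)) :
  A3 A (Bdry3 x0 x0 x1 x2 (id_edge i) x01 x02 x01 x02 x12
          (lu_tri u01) (lu_tri u02) x012 x012).
Proof.
  destruct (contr_horn3_1 A segal
              (Horn3_1 _ _ _ _ _ _ _ _ _ _ (lu_comp u01) (lu_comp u02) x012))
    as [[b c] _].
  exact (projT1 (projT1 (isContr_filler4_0 segal
    _ _ _ _ _ _ (id_isNeutral i) _ _ _ _ _ _ _ _ _ _ _ _ _ _ _ _ _ _ _
    (lu_coh u01) (lu_coh u02) c c))).
Qed.

(** The 4-horn has the vertices [x0, id_src i, x1, x1, x2].  Its two equal faces
    arise by factoring the edge [x01] of [x012] through the neutral edge into
    [x1]; the two unitors supply the faces 0123 and 1234. *)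
Lemma degenerate_middle {A : sst4} (segal : isSemiSegal A) {x0 x1 x2 : A0 A}
    (i : identity A x1) {x01 x02 x12}
    (u01 : right_unitor i x01) (u12 : left_unitor i x12)
    (x012 : A2 A (Bdry2 x0 x1 x2 x01 x02 x12)) :
  A3 A (Bdry3 x0 x1 x1 x2 x01 x01 x02 (id_edge i) x12 x12
          (ru_tri u01) x012 x012 (lu_tri u12)).
Proof.
  destruct (isContr_filler3_2 segal
              _ _ _ _ _ _ _ _ _ _ (ru_comp u01) x012 (lu_comp u12))
    as [[b c] _].
  exact (projT1 (projT1 (contr_horn4_1 A segal
    (Horn4_1 _ _ _ _ _ _ _ _ _ _ _ _ _ _ _ _ _ _ _ _ _ _ _ _ _
      (ru_coh u01) c c (lu_coh u12))))).
Qed.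

(** The 4-horn has the vertices [x0, x1, id_src i, x2, x2].  Its two equal faces
    arise by factoring the edges [x02] and [x12] of [x012] through the neutral
    edge into [x2]. *)
Lemma degenerate_last {A : sst4} (segal : isSemiSegal A) {x0 x1 x2 : A0 A}
    (i : identity A x2) {x01 x02 x12}
    (u02 : right_unitor i x02) (u12 : right_unitor i x12)
    (x012 : A2 A (Bdry2 x0 x1 x2 x01 x02 x12)) :
  A3 A (Bdry3 x0 x1 x2 x2 x01 x02 x02 x12 x12 (id_edge i)
          x012 x012 (ru_tri u02) (ru_tri u12)).
Proof.
  destruct (isContr_filler3_3 segal
              _ _ _ _ _ (id_isNeutral i) _ _ _ _ _
              x012 (ru_comp u02) (ru_comp u12))
    as [[b c] _].
  exact (projT1 (projT1 (isContr_filler4_2 segal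
    _ _ _ _ _ _ _ _ _ _ _ _ _ _ _ _ _ _ _ _ _ _ _ _ _
    c c (ru_coh u02) (ru_coh u12)))).
Qed.

Theorem lemma5p9 (A : sst4) (segal : isSemiSegal A) (complete : isComplete A) :
  degeneracy3 A.
Proof.
  pose (i := complete_identity complete).
  pose (l := fun (x z : A0 A) (f : A1 A (Bdry1 x z)) =>
               has_left_unitor segal (i x) f).
  pose (r := fun (z x : A0 A) (f : A1 A (Bdry1 z x)) =>
               has_right_unitor segal (i x) f).
  unshelve refine (Build_degeneracy3 A (Build_degeneracy2 A _ _ _) _ _ _).
  - exact (fun x => id_edge (i x)).
  - exact (fun x => lu_tri (l _ _ (simplex1_01 x))).
  - exact (fun x => ru_tri (r _ _ (simplex1_01 x))).
  - exact (fun x => degenerate_first segal (i _) (l _ _ _) (l _ _ _)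
                      (simplex2_012 x)).
  - exact (fun x => degenerate_middle segal (i _) (r _ _ _) (l _ _ _)
                      (simplex2_012 x)).
  - exact (fun x => degenerate_last segal (i _) (r _ _ _) (r _ _ _)
                      (simplex2_012 x)).
Qed.
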